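(* Let $X$ be a finite set of variables and $Z_1,P_1,Z_2,P_2\subseteq\mathbb{Q}[X]$ finite sets of polynomials. Then \[ \mathrm{alg.cone}_X(\mathit{intersect}(Z_1,P_1,Z_2,P_2)) = \mathrm{alg.cone}_X(Z_1,P_1)\cap\mathrm{alg.cone}_X(Z_2,P_2). \]
   Context: For finite $Z,P \subseteq \mathbb{Q}[V]$, $\mathrm{alg.cone}_V(Z,P) = \langle Z\rangle_V + \mathrm{cone}(P)$ ($\langle Z\rangle_V$ the ideal of $\mathbb{Q}[V]$ generated by $Z$; $\mathrm{cone}(P)$ the non-negative rational combinations of $P$). Let $t \notin X$ be a fresh variable and for a polynomial $f$ and set $S$ write $fS = \{fs : s\in S\}$. Define $\mathit{intersect}(Z_1,P_1,Z_2,P_2) = \mathit{project}_X(tZ_1\cup(1-t)Z_2,\ tP_1\cup(1-t)P_2)$, computed in $\mathbb{Q}[X\cup\{t\}]$. Here, for $X\subseteq Y$ and finite $Z,P\subseteq\mathbb{Q}[Y]$: fix a monomial ordering $\preceq$; the elimination ordering $\preceq_X$ compares monomials $m=m_Xm_{\overline X}$, $n=n_Xn_{\overline X}$ (factored into parts over $X$ and over $Y\setminus X$) by $m\preceq_X n$ iff $m_{\overline X}\prec n_{\overline X}$, or $m_{\overline X}=n_{\overline X}$ and $m_X\preceq n_X$; $\mathit{project}_X(Z,P) = \langle G\cap\mathbb{Q}[X],\ \mathrm{proj}(\{\mathbf{red}_G(p):p\in P\},[X])\rangle$ where $G$ is a Gröbner basis of the ideal generated by $Z$ in $\mathbb{Q}[Y]$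 w.r.t. $\preceq_X$, $\mathbf{red}_G$ is normal form modulo $G$, $[X]$ is the set of monomials over $X$, and $\mathrm{proj}(S,N)$ is a finite set with $\mathrm{cone}(\mathrm{proj}(S,N))=\mathrm{cone}(S)\cap\mathrm{span}_{\mathbb{Q}}(N)$. *)

(* Defs.v *)
From HB Require Import structures.
From mathcomp Require Import all_boot all_order all_algebra.
From mathcomp Require Import finmap.
From mathcomp Require Import mpoly.

Set Implicit Arguments.
Unset Strict Implicit.
Unset Printing Implicit Defensive.

Import GRing.Theory Num.Theory.
Local Open Scope fset_scope.
Local Open Scope ring_scope.

(* All variables live in an ambient finite supply 'I_n; a set of variables is
   V : {set 'I_n}, [V] is [monos V] and Q[V] is the subset [polys V] of
   {mpoly rat[n]}. *)

Definition monos (n : nat) (V : {set 'I_n}) : {pred 'X_{1..n}} :=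
  [pred m : 'X_{1..n} | [forall i, (i \notin V) ==> (m i == 0%N)]].

Definition polys (n : nat) (V : {set 'I_n}) : {pred {mpoly rat[n]}} :=
  [pred p : {mpoly rat[n]} | all (monos V) (msupp p)].

Definition ideal (n : nat) (V : {set 'I_n}) (Z : {fset {mpoly rat[n]}})
    (f : {mpoly rat[n]}) : Prop :=
  exists2 q : {mpoly rat[n]} -> {mpoly rat[n]},
    (forall z, z \in Z -> q z \in polys V) & f = \sum_(z <- Z) q z * z.

Definition cone (n : nat) (P : {fset {mpoly rat[n]}})
    (f : {mpoly rat[n]}) : Prop :=
  exists2 c : {mpoly rat[n]} -> rat,
    (forall p, p \in P -> 0 <= c p) & f = \sum_(p <- P) c p *: p.

Definition alg_cone (n : nat) (V : {set 'I_n}) (Z P : {fset {mpoly rat[n]}})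
    (f : {mpoly rat[n]}) : Prop :=
  exists g h, [/\ ideal V Z g, cone P h & f = g + h].

Definition span (n : nat) (N : {pred 'X_{1..n}}) (f : {mpoly rat[n]}) : Prop :=
  exists (s : seq 'X_{1..n}) (c : 'X_{1..n} -> rat),
    {subset s <= N} /\ f = \sum_(m <- s) c m *: 'X_[m].

Definition monomial_order (n : nat) (Y : {set 'I_n}) (le : rel 'X_{1..n}) :
    Prop :=
  [/\ {in monos Y &, total le},
      {in monos Y &, antisymmetric le},
      {in monos Y & &, transitive le},
      {in monos Y & &, forall m1 m2 m,
         le m1 m2 -> le (m + m1)%MM (m + m2)%MM}
    & forall S : 'X_{1..n} -> Prop,
        (forall m, S m -> m \in monos Y) -> (exists m, S m) ->
        exists2 m, S m & forall m', S m' -> le m m'].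

Definition mpart (n : nat) (V : {set 'I_n}) (m : 'X_{1..n}) : 'X_{1..n} :=
  [multinom (if i \in V then m i else 0%N) | i < n].

Definition elim_order (n : nat) (X Y : {set 'I_n}) (le : rel 'X_{1..n}) :
    rel 'X_{1..n} :=
  fun m1 m2 =>
    let m1' := mpart (Y :\: X) m1 in
    let m2' := mpart (Y :\: X) m2 in
    ((m1' != m2') && le m1' m2')
    || ((m1' == m2') && le (mpart X m1) (mpart X m2)).

(* Only nonzero polynomials have a leading monomial. *)
Definition is_lead (n : nat) (le : rel 'X_{1..n}) (p : {mpoly rat[n]})
    (m : 'X_{1..n}) : Prop :=
  m \in msupp p /\ forall m', m' \in msupp p -> le m' m.

(* (m1 <= m2)%MM is divisibility of monomials. *)
Definition groebner_basis (n : nat) (Y : {set 'I_n}) (le : rel 'X_{1..n})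
    (Z G : {fset {mpoly rat[n]}}) : Prop :=
  (forall g, g \in G -> ideal Y Z g) /\
  (forall f m, ideal Y Z f -> is_lead le f m ->
     exists g mg, [/\ g \in G, is_lead le g mg & (mg <= m)%MM]).

Definition normal_form (n : nat) (Y : {set 'I_n}) (le : rel 'X_{1..n})
    (G : {fset {mpoly rat[n]}}) (p r : {mpoly rat[n]}) : Prop :=
  ideal Y G (p - r) /\
  (forall m g mg, m \in msupp r -> g \in G -> is_lead le g mg ->
     ~~ (mg <= m)%MM).

Definition is_proj (n : nat) (S : {fset {mpoly rat[n]}}) (N : {pred 'X_{1..n}})
    (S' : {fset {mpoly rat[n]}}) : Prop :=
  forall f, cone S' f <-> cone S f /\ span N f.

(* A Groebner basis and the finite generating set returned by proj are not
   unique, so project is the relation between its arguments and any possible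
   output. *)
Definition is_project (n : nat) (le : rel 'X_{1..n}) (X Y : {set 'I_n})
    (Z P : {fset {mpoly rat[n]}})
    (out : {fset {mpoly rat[n]}} * {fset {mpoly rat[n]}}) : Prop :=
  let leX := elim_order X Y le in
  exists (G : {fset {mpoly rat[n]}}) (red : {mpoly rat[n]} -> {mpoly rat[n]}),
    [/\ groebner_basis Y leX Z G,
        forall p, p \in polys Y -> normal_form Y leX G p (red p),
        out.1 = [fset g in G | g \in polys X]
      & is_proj [fset red p | p in P] (monos X) out.2].

Definition scale_fset (n : nat) (f : {mpoly rat[n]})
    (S : {fset {mpoly rat[n]}}) : {fset {mpoly rat[n]}} :=
  [fset f * s | s in S].

Definition is_intersect (n : nat) (le : rel 'X_{1..n}) (X : {set 'I_n})
    (t : 'I_n) (Z1 P1 Z2 P2 : {fset {mpoly rat[n]}})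
    (out : {fset {mpoly rat[n]}} * {fset {mpoly rat[n]}}) : Prop :=
  is_project le X (t |: X)%SET
    (scale_fset 'X_t Z1 `|` scale_fset (1 - 'X_t) Z2)
    (scale_fset 'X_t P1 `|` scale_fset (1 - 'X_t) P2)
    out.

(* Main.v *)
Require Import Defs.
From HB Require Import structures.
From mathcomp Require Import all_boot all_order all_algebra.
From mathcomp Require Import finmap.
From mathcomp Require Import mpoly.
From Stdlib Require Import Classical_Prop.

(** Write [Y] for [X] with [t] added.  Projection computes the polynomials of
    [Q[X]] that lie in an algebraic cone over [Y]: if [f = g + h] with [g] in the
    ideal and [h] a non-negative combination of normal forms, then a leading
    monomial of [f - h] outside [[X]] would occur in [h], although it is divisible
    by the leading monomial of an element of the Groebner basis.  Hence [f - h]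
    lies in [Q[X]], and in the elimination ideal.
    For the intersection, the substitutions [t := 1] and [t := 0] send the cone
    over [Y] to each of the two given cones and fix [Q[X]]; conversely [f] in
    both cones is recovered from [f = t f + (1 - t) f]. *)

Section Polys.
Set Implicit Arguments.
Unset Strict Implicit.
Unset Printing Implicit Defensive.
Import GRing.Theory Num.Theory.
Local Open Scope fset_scope.
Local Open Scope ring_scope.
Variable n : nat.
Implicit Types (V X Y : {set 'I_n}) (m : 'X_{1..n}) (p q f g h : {mpoly rat[n]}).
Implicit Types (Z P G : {fset {mpoly rat[n]}}) (le : rel 'X_{1..n}).

(** * Monomials and polynomials over a set of variables *)

Lemma monosP V m : reflect (forall i, i \notin V -> m i = 0%N) (m \in monos V).
Proof.
apply: (iffP forallP) => [h i iV|h i].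
  by apply/eqP; move: (h i); rewrite iV.
by apply/implyP => /h ->.
Qed.

Lemma monosS X Y : X \subset Y -> {subset monos X <= monos Y}.
Proof.
move=> sXY m /monosP mX; apply/monosP => i iY; apply: mX.
by apply: contra iY; apply/subsetP.
Qed.

Lemma monos0 V : 0%MM \in monos V.
Proof. by apply/monosP => i _; rewrite mnm0E. Qed.

Lemma monosD V m1 m2 :
  m1 \in monos V -> m2 \in monos V -> (m1 + m2)%MM \in monos V.
Proof.
by move=> /monosP h1 /monosP h2; apply/monosP => i iV; rewrite mnmDE h1 ?h2.
Qed.

Lemma monos_dvd V m1 m2 : (m1 <= m2)%MM -> m2 \in monos V -> m1 \in monos V.
Proof.
move=> /mnm_lepP h /monosP h2; apply/monosP => i iV.
by apply/eqP; rewrite -leqn0 -(h2 _ iV).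
Qed.

Lemma polysP V p :
  reflect (forall m, m \in msupp p -> m \in monos V) (p \in polys V).
Proof. exact: allP. Qed.

Lemma polys_subalg V : subalg_closed (polys V).
Proof.
split=> [|c p q /polysP hp /polysP hq|p q /polysP hp /polysP hq];
    apply/polysP => m.
- by rewrite msupp1 inE => /eqP ->; exact: monos0.
- by move/msuppD_le; rewrite mem_cat => /orP[/msuppZ_le/hp|/hq].
- by move/msuppM_le => /allpairsP[[m1 m2] /= [/hp h1 /hq h2 ->]]; exact: monosD.
Qed.

HB.instance Definition _ V :=
  GRing.isSubalgClosed.Build rat {mpoly rat[n]} (polys V) (polys_subalg V).

Lemma polysS X Y : X \subset Y -> {subset polys X <= polys Y}.
Proof.
by move=> sXY p /polysP h; apply/polysP => m /h; exact: monosS.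
Qed.

Lemma polys_mon V m : m \in monos V -> 'X_[m] \in polys V.
Proof. by move=> hm; apply/polysP => m'; rewrite msuppX inE => /eqP ->. Qed.

Lemma spanP V f : Defs.span (monos V) f <-> f \in polys V.
Proof.
split=> [[s [c [sV ->]]]|/polysP h].
  rewrite big_seq; apply: rpred_sum => m /sV hm; apply: rpredZ.
  exact: polys_mon.
by exists (msupp f), (fun m => f@_m); split => //; exact: mpolyE.
Qed.

(** * Ideals *)

Lemma ideal_ind V Z (K : {mpoly rat[n]} -> Prop) :
  K 0 -> (forall f g, K f -> K g -> K (f + g)) ->
  (forall q z, q \in polys V -> z \in Z -> K (q * z)) ->
  forall f, ideal V Z f -> K f.
Proof.
by move=> K0 KD KM f [q hq ->]; rewrite big_seq; apply: big_ind => // z zZ; auto.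
Qed.

Lemma ideal0 V Z : ideal V Z 0.
Proof.
exists (fun=> 0); first by move=> z _; exact: rpred0.
by rewrite big1 // => z _; rewrite mul0r.
Qed.

Lemma idealD V Z f g : ideal V Z f -> ideal V Z g -> ideal V Z (f + g).
Proof.
move=> [q hq ->] [r hr ->]; exists (fun z => q z + r z).
  by move=> z zZ; apply: rpredD; auto.
by rewrite -big_split; apply: eq_bigr => z _; rewrite mulrDl.
Qed.

Lemma idealM V Z q f : q \in polys V -> ideal V Z f -> ideal V Z (q * f).
Proof.
move=> hq [r hr ->]; exists (fun z => q * r z).
  by move=> z zZ; apply: rpredM; auto.
by rewrite big_distrr; apply: eq_bigr => z _; rewrite /= mulrA.
Qed.

Lemma idealZ V Z c f : ideal V Z f -> ideal V Z (c *: f).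
Proof.
move=> hf; rewrite -mul_mpolyC; apply: idealM => //.
by rewrite -alg_mpolyC; apply: rpredZ; exact: rpred1.
Qed.

Lemma idealB V Z f g : ideal V Z f -> ideal V Z g -> ideal V Z (f - g).
Proof. by move=> hf hg; rewrite -scaleN1r; apply: idealD => //; apply: idealZ. Qed.

Lemma ideal_gen V Z z : z \in Z -> ideal V Z z.
Proof.
move=> zZ; exists (fun y => (y == z)%:R).
  by move=> y _; case: (y == z); [exact: rpred1|exact: rpred0].
rewrite (bigD1_seq z) //= eqxx mul1r big1 ?addr0 // => y /negPf ->.
by rewrite mul0r.
Qed.

(** Serves both to exchange generators and to enlarge the set of variables from which the
    coefficients come. *)
Lemma ideal_sub V X Z Z' : V \subset X -> (forall z, z \in Z -> ideal X Z' z) ->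
  forall f, ideal V Z f -> ideal X Z' f.
Proof.
move=> sVX hZ; apply: ideal_ind; [exact: ideal0|by move=> *; exact: idealD|].
by move=> q z /(polysS sVX) hq /hZ; exact: idealM.
Qed.

Lemma ideal_polys V Z f : {subset Z <= polys V} -> ideal V Z f -> f \in polys V.
Proof.
move=> hZ [q hq ->]; rewrite big_seq; apply: rpred_sum => z zZ.
by apply: rpredM; auto.
Qed.

(** * Cones *)

Lemma cone_ind P (K : {mpoly rat[n]} -> Prop) :
  K 0 -> (forall f g, K f -> K g -> K (f + g)) ->
  (forall c p, 0 <= c -> p \in P -> K (c *: p)) ->
  forall f, cone P f -> K f.
Proof.
by move=> K0 KD KM f [c hc ->]; rewrite big_seq; apply: big_ind => // z zZ; auto.
Qed.

Lemma cone0 P : cone P 0.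
Proof. by exists (fun=> 0) => //; rewrite big1 // => z _; rewrite scale0r. Qed.

Lemma coneD P f g : cone P f -> cone P g -> cone P (f + g).
Proof.
move=> [q hq ->] [r hr ->]; exists (fun z => q z + r z).
  by move=> z zZ; apply: addr_ge0; auto.
by rewrite -big_split; apply: eq_bigr => z _; rewrite scalerDl.
Qed.

Lemma coneZ P (c : rat) p : 0 <= c -> p \in P -> cone P (c *: p).
Proof.
move=> c0 pP; exists (fun y => (y == p)%:R * c).
  by move=> y _; apply: mulr_ge0 => //; exact: ler0n.
rewrite (bigD1_seq p) ?fset_uniq //= eqxx mul1r big1 ?addr0 // => y /negPf ->.
by rewrite mul0r scale0r.
Qed.

Lemma cone_polys V P f : {subset P <= polys V} -> cone P f -> f \in polys V.
Proof.
move=> hP [c _ ->]; rewrite big_seq; apply: rpred_sum => p pP.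
by apply: rpredZ; exact: hP.
Qed.

(** * The elimination ordering and elimination ideals *)

Lemma mpart_monos V Y m : m \in monos Y -> mpart V m \in monos Y.
Proof.
by move=> /monosP h; apply/monosP => i iY; rewrite mnmE h // if_same.
Qed.

Lemma mpart_id X m : m \in monos X -> mpart X m = m.
Proof.
move=> /monosP h; apply/mnmP => i; rewrite mnmE.
by case: ifPn => // /h.
Qed.

Lemma mpart_setD_eq0 X Y m : m \in monos Y ->
  (mpart (Y :\: X) m == 0%MM) = (m \in monos X).
Proof.
move=> /monosP mY; apply/eqP/monosP => [/mnmP h i iX|h].
  move: (h i); rewrite mnmE mnm0E inE iX /=; case: ifPn => // iY _.
  exact: mY.
by apply/mnmP => i; rewrite mnmE mnm0E inE; case: ifP => // /andP[/h].
Qed.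

Section Order.
Variables (X Y : {set 'I_n}) (le : rel 'X_{1..n}).
Hypotheses (sXY : X \subset Y) (leP : monomial_order Y le).

Let le_total : {in monos Y &, total le}. Proof. by case: leP. Qed.
Let le_anti m1 m2 : m1 \in monos Y -> m2 \in monos Y ->
  le m1 m2 -> le m2 m1 -> m1 = m2.
Proof. by case: leP => _ h _ _ _ h1 h2 a b; apply: h => //; rewrite a. Qed.
Let le_trans : {in monos Y & &, transitive le}. Proof. by case: leP. Qed.
Let le_add : {in monos Y & &, forall m1 m2 m,
  le m1 m2 -> le (m + m1)%MM (m + m2)%MM}.
Proof. by case: leP. Qed.

(** The well-ordering provides a least monomial [m0]. Adding [m0] to [m0 <= 0] gives
    [m0 + m0 <= m0], minimality gives the reverse, so [m0 + m0 = m0] and [m0] is trivial. *)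
Lemma monomial_order_ge0 m : m \in monos Y -> le 0%MM m.
Proof.
case: (leP) => _ _ _ _ wf.
have [|m0 m0Y hm0] := wf (fun m => m \in monos Y) (fun _ => id).
  by exists 0%MM; exact: monos0.
move=> mY; suff <- : m0 = 0%MM by exact: hm0.
have Y0 := monos0 Y.
have h := le_add m0Y Y0 m0Y (hm0 _ Y0); rewrite addm0 in h.
have /mnmP e := le_anti (monosD m0Y m0Y) m0Y h (hm0 _ (monosD m0Y m0Y)).
apply/mnmP => i; move: (e i); rewrite mnmDE mnm0E.
by rewrite -{3}[m0 i]addn0 => /addnI.
Qed.

Local Notation leX := (elim_order X Y le).

Lemma elim_order_total : {in monos Y &, total leX}.
Proof.
move=> a b aY bY; rewrite /elim_order /=.
have := le_total (mpart_monos (Y :\: X) aY) (mpart_monos (Y :\: X) bY).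
have := le_total (mpart_monos X aY) (mpart_monos X bY).
by rewrite [mpart _ b == _]eq_sym; case: eqVneq => //= _; rewrite ?orbF.
Qed.

Lemma elim_order_trans : {in monos Y & &, transitive leX}.
Proof.
move=> b a c bY aY cY; rewrite /elim_order /=.
have pY V m : m \in monos Y -> mpart V m \in monos Y := @mpart_monos V Y m.
have tX := le_trans (pY X b bY) (pY X a aY) (pY X c cY).
have := pY (Y :\: X) a aY; move: (mpart (Y :\: X) a) => a' a'Y.
have := pY (Y :\: X) b bY; move: (mpart (Y :\: X) b) => b' b'Y.
have := pY (Y :\: X) c cY; move: (mpart (Y :\: X) c) => c' c'Y.
have [->|ab] := eqVneq a' b'; have [<-|bc] := eqVneq b' c'; rewrite ?orbF //=.
  by rewrite (negPf ab) /= orbF.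
(* Both comparisons are strict outside [X]. If [a'] and [c'] coincided, then [a'] and [b'] would
   bound each other and be equal. *)
move=> h1 h2; case: eqVneq => [e|_] /=; last by rewrite (le_trans b'Y a'Y c'Y).
by case/eqP: ab; apply: le_anti => //; rewrite e.
Qed.

(** The parts outside [X] are both trivial, so the comparison is decided over [X]. This makes the
    well-foundedness of [le] available for leading monomials in [X] with respect to [leX]. *)
Lemma elim_order_in m1 m2 : m1 \in monos X -> m2 \in monos X ->
  leX m1 m2 = le m1 m2.
Proof.
move=> h1 h2; have sY := monosS sXY.
rewrite /elim_order /= !(@mpart_id X) //.
have /eqP -> : mpart (Y :\: X) m1 == 0%MM by rewrite mpart_setD_eq0 ?sY.
have /eqP -> : mpart (Y :\: X) m2 == 0%MM by rewrite mpart_setD_eq0 ?sY.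
by rewrite eqxx.
Qed.

(** The part of [m2] outside [X] is [0], the least monomial, so that of [m1] is [0] as well. Hence a
    polynomial over [Y] whose leading monomial is in [X] lies entirely in Q[X]. *)
Lemma elim_order_down m1 m2 : m1 \in monos Y -> m2 \in monos X ->
  leX m1 m2 -> m1 \in monos X.
Proof.
move=> h1 h2; have h2Y := monosS sXY h2.
rewrite /elim_order /=.
have /eqP -> : mpart (Y :\: X) m2 == 0%MM by rewrite mpart_setD_eq0.
rewrite -(@mpart_setD_eq0 X Y) //; case: eqVneq => //= ne; rewrite orbF => h.
case/eqP: ne; apply: le_anti => //; first exact: mpart_monos.
  exact: monos0.
by apply: monomial_order_ge0; exact: mpart_monos.
Qed.

Lemma elim_lead_exists p : p \in polys Y -> p != 0 -> exists m, is_lead leX p m.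
Proof.
move=> /polysP hp; rewrite -msupp_eq0 /is_lead.
elim: (msupp p) hp => // m s IH hs _.
have mY : m \in monos Y by apply: hs; rewrite inE eqxx.
have refl : leX m m by have := elim_order_total mY mY; rewrite orbb.
have [s0|s0] := eqVneq s [::].
  by exists m; rewrite s0 inE eqxx; split => // m'; rewrite inE => /eqP ->.
have hs' m' : m' \in s -> m' \in monos Y by move=> h; apply: hs; rewrite inE h orbT.
have [k [ks hk]] := IH hs' s0.
have [mk|km] := orP (elim_order_total mY (hs' _ ks)).
  exists k; split; first by rewrite inE ks orbT.
  by move=> m'; rewrite inE => /orP[/eqP ->|/hk].
exists m; split; first by rewrite inE eqxx.
move=> m'; rewrite inE => /orP[/eqP ->//|m's].
by apply: elim_order_trans (hk _ m's) km; auto.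
Qed.

(* A counterexample with least leading monomial would be reduced to a smaller
   one by the Groebner basis. *)
Lemma elimination Z G : {subset Z <= polys Y} -> groebner_basis Y leX Z G ->
  forall f, ideal Y Z f -> f \in polys X ->
  ideal X [fset g in G | g \in polys X] f.
Proof.
move=> ZY [GZ Glead]; set GX := [fset g in G | _].
pose bad f := [/\ ideal Y Z f, f \in polys X & ~ ideal X GX f].
pose S m := exists f, bad f /\ is_lead leX f m.
have bad_lead f : bad f -> exists m, is_lead leX f m.
  case=> _ fX nf; apply: elim_lead_exists; first exact: polysS fX.
  by apply/eqP => f0; apply: nf; rewrite f0; exact: ideal0.
suff nobad f : ~ bad f.
  by move=> f fI fX; apply: NNPP => nf; apply: (nobad f).
move=> badf.
(* Choose a bad [f0] whose [leX]-leading monomial [m] is [le]-minimal; all these monomials are in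
   [X]. *)
case: (leP) => _ _ _ _ /(_ S)[||m [f0 [[f0I f0X nf0] [mf0 leadf0]]] minm].
- by move=> m [g [[_ /polysP gX _] [mg _]]]; apply: monosS sXY _ _; exact: gX.
- by have [m hm] := bad_lead _ badf; exists m, f.
have mX : m \in monos X by apply: (polysP _ _ f0X).
have [g [mg [gG [mgg leadg] dvd]]] := Glead f0 m f0I (conj mf0 leadf0).
(* A divisor of a monomial over [X] is over [X], and the leading monomial decides that all of [g] is
   over [X]. *)
have mgX := monos_dvd dvd mX.
have gY : g \in polys Y by apply: ideal_polys ZY (GZ _ gG).
have gX : g \in polys X.
  apply/polysP => m' m'g; apply: elim_order_down mgX (leadg _ m'g).
  exact: (polysP _ _ gY).
have dX : (m - mg)%MM \in monos X.
  by apply: (monos_dvd _ mX); apply/mnm_lepP => i; rewrite mnmBE leq_subr.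
(* The multiplier for which [r * g] has the same term at [m] as [f0]. *)
pose r := (f0@_m / g@_mg) *: 'X_[m - mg].
have rX : r \in polys X by apply: rpredZ; exact: polys_mon.
have gGX : g \in GX by rewrite !inE gG.
have bad1 : bad (f0 - r * g).
  split.
  - by apply: idealB => //; apply: idealM (GZ _ gG); exact: polysS rX.
  - by apply: rpredB => //; apply: rpredM.
  - move=> h; apply: nf0; rewrite -(subrK (r * g) f0); apply: idealD => //.
    by apply: idealM => //; exact: ideal_gen.
have [k hk] := bad_lead _ bad1; have mk := minm k (ex_intro _ _ (conj bad1 hk)).
case: hk => kf _.
have kX : k \in monos X by case: bad1 => _ /polysP h _; exact: h.
have sY := monosS sXY.
(* A monomial of [f0 - r * g] comes from [f0], where [m] dominates, or is [m - mg] plus a monomial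
   of [g], where [mg] dominates and [(m - mg) + mg = m]. *)
have km : le k m.
  move: kf => /msuppD_le; rewrite mem_cat => /orP[/leadf0|].
    by rewrite elim_order_in.
  rewrite (perm_mem (msuppN _)) /r -scalerAl => /msuppZ_le.
  rewrite mulrC (perm_mem (msuppMX _ _)) => /mapP[m' m'g ->].
  rewrite -{2}(submK dvd); apply: le_add; try exact: sY.
    by apply: sY; apply: (polysP _ _ gX).
  rewrite -elim_order_in //; first exact: leadg.
  exact: (polysP _ _ gX).
(* Minimality of [m] gives the other inequality; but the coefficient at [m] has been cancelled. *)
have ekm : k = m by apply: le_anti => //; exact: sY.
have cancel : ('X_[m - mg] * g)@_m = g@_mg.
  by rewrite -[RHS](mcoeffMX g (m - mg) mg) submK // mulrC.
move: kf; rewrite ekm mcoeff_msupp mcoeffB /r -scalerAl mcoeffZ cancel.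
by rewrite mulfVK ?subrr ?eqxx // -mcoeff_msupp.
Qed.

(** * Projection of an algebraic cone *)

Lemma project_alg_cone Z P out :
  {subset Z <= polys Y} -> {subset P <= polys Y} ->
  is_project le X Y Z P out ->
  forall f, alg_cone X out.1 out.2 f <-> alg_cone Y Z P f /\ f \in polys X.
Proof.
move=> ZY PY [G [red [GB redP -> projP]]] f.
have [GZ Glead] := GB.
have GtoZ g : ideal Y G g -> ideal Y Z g by apply: ideal_sub.
have redZ p : p \in P -> ideal Y Z (p - red p).
  by move=> /PY /redP[/GtoZ].
have redY p : p \in P -> red p \in polys Y.
  move=> pP; rewrite -(subKr p (red p)); apply: rpredB; first exact: PY.
  by apply: ideal_polys ZY _; exact: redZ.
split=> [[g [h [gI /projP[hC /spanP hX] ->]]]|[[g [h [gI hC fE]]] fX]].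
  split; last first.
    by apply: rpredD => //; apply: ideal_polys gI => z; rewrite !inE => /andP[].
  have {}gI : ideal Y Z g.
    by apply: ideal_sub gI => // z; rewrite !inE => /andP[/GZ].
  suff [h' h'C h'Z] : exists2 h', cone P h' & ideal Y Z (h - h').
    exists (g + (h - h')), h'; split => //; first exact: idealD.
    by rewrite -addrA subrK.
  move: h hC {hX}; apply: cone_ind.
  - by exists 0; [exact: cone0|rewrite subr0; exact: ideal0].
  - move=> a b [a' ? ?] [b' ? ?]; exists (a' + b'); first exact: coneD.
    by rewrite opprD addrACA; exact: idealD.
  - move=> c _ c0 /imfsetP[p /= pP ->]; exists (c *: p); first exact: coneZ.
    by rewrite -scalerBr -opprB scalerN -scaleNr; apply: idealZ; exact: redZ.
(* The normal form condition survives sums and scalar multiples, since these create no new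
   monomials; so it holds on the whole cone of normal forms. *)
pose reduced h := forall m g mg, m \in msupp h -> g \in G ->
  is_lead leX g mg -> ~~ (mg <= m)%MM.
have [h' [h'C h'Z h'r]] : exists h', [/\ cone [fset red p | p in P] h',
    ideal Y Z (h - h') & reduced h'].
  move: h hC {fE}; apply: cone_ind.
  - exists 0; split; [exact: cone0|rewrite subr0; exact: ideal0|].
    by move=> m g' mg; rewrite msupp0.
  - move=> a b [a' [? ? ra]] [b' [? ? rb]]; exists (a' + b'); split.
    + exact: coneD.
    + by rewrite opprD addrACA; exact: idealD.
    + move=> m g' mg /msuppD_le; rewrite mem_cat => /orP[/ra|/rb]; exact.
  - move=> c p c0 pP; exists (c *: red p); split.
    + by apply: coneZ => //; apply/imfsetP; exists p.
    + by rewrite -scalerBr; apply: idealZ; exact: redZ.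
    + have [_ rp] := redP p (PY _ pP).
      by move=> m g' mg /msuppZ_le; exact: rp.
have h'Y : h' \in polys Y.
  by apply: cone_polys h'C => _ /imfsetP[p /= pP ->]; exact: redY.
have fh'Z : ideal Y Z (f - h').
  by rewrite fE -addrA; exact: idealD.
have fh'X : f - h' \in polys X.
  (* The zero polynomial has no leading monomial and is treated apart. *)
  have [->|nz] := eqVneq (f - h') 0; first exact: rpred0.
  have fh'Y : f - h' \in polys Y by apply: ideal_polys fh'Z.
  have [m leadm] := elim_lead_exists fh'Y nz; have [ms hm] := leadm.
  suff mX : m \in monos X.
    apply/polysP => m' m's; apply: elim_order_down mX (hm _ m's).
    exact: (polysP _ _ fh'Y).
  have [g' [mg [g'G lg' dvd]]] := Glead _ _ fh'Z leadm.
  move: ms => /msuppD_le; rewrite mem_cat => /orP[|]; first exact: (polysP _ _ fX).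
  by rewrite (perm_mem (msuppN _)) => /h'r/(_ g'G lg'); rewrite dvd.
(* With [f] and [f - h'] in Q[X], [h'] is in the part of the cone that [is_proj] retains. *)
have h'X : h' \in polys X by rewrite -(subKr f h'); apply: rpredB.
exists (f - h'), h'; split; last by rewrite subrK.
- exact: elimination fh'Z fh'X.
- by apply/projP; split => //; exact/spanP.
Qed.

End Order.

(** * Substituting a constant for [t] *)

Section Subst.
Variables (X : {set 'I_n}) (t : 'I_n) (c : rat).
Hypothesis tX : t \notin X.

Definition subst_tuple : n.-tuple {mpoly rat[n]} :=
  [tuple (if i == t then c%:MP else 'X_i) | i < n].

Definition subst_var : {mpoly rat[n]} -> {mpoly rat[n]} :=
  comp_mpoly subst_tuple.

HB.instance Definition _ :=
  GRing.LRMorphism.copy subst_var (comp_mpoly subst_tuple).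

Lemma subst_varX : subst_var 'X_t = c%:MP.
Proof. by rewrite /subst_var comp_mpolyXU -tnth_nth tnth_mktuple eqxx. Qed.

Lemma subst_var_id p : p \in polys X -> subst_var p = p.
Proof.
move=> /polysP pX; rewrite /subst_var comp_mpolyE [RHS]mpolyE.
apply: eq_big_seq => m /pX /monosP mX; congr (_ *: _).
rewrite mpolyXE_id; apply: eq_bigr => i _; rewrite tnth_mktuple.
(* At [t] the exponent is [0], because [t] is not in [X], so the replaced factor is [1]. *)
by case: eqVneq => // ->; rewrite mX // !expr0.
Qed.

Lemma subst_var_polys p : p \in polys (t |: X)%SET -> subst_var p \in polys X.
Proof.
move=> /polysP pX; rewrite /subst_var comp_mpolyE big_seq.
apply: rpred_sum => m /pX /monosP mX; apply: rpredZ; apply: rpred_prod => i _.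
rewrite tnth_mktuple; case: eqVneq => [_|it].
  by apply: rpredX; rewrite -alg_mpolyC; apply: rpredZ; exact: rpred1.
have [iX|iX] := boolP (i \in X); last first.
  by rewrite mX ?expr0 ?rpred1 // !inE negb_or it.
apply: rpredX; apply: polys_mon; apply/monosP => j jX; rewrite mnm1E.
by case: eqVneq => // ij; rewrite -ij iX in jX.
Qed.

Lemma subst_var_ideal Z Z' : (forall z, z \in Z -> ideal X Z' (subst_var z)) ->
  forall f, ideal (t |: X)%SET Z f -> ideal X Z' (subst_var f).
Proof.
move=> hZ; apply: ideal_ind.
- by rewrite rmorph0; exact: ideal0.
- by move=> f g hf hg; rewrite rmorphD; exact: idealD.
- by move=> q z /subst_var_polys hq /hZ hz; rewrite rmorphM; exact: idealM.
Qed.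

(** The factor [d] is part of the hypothesis because an image may be [0] instead of a generator;
    each case is then settled directly. *)
Lemma subst_var_cone P P' :
  (forall d p, 0 <= d -> p \in P -> cone P' (d *: subst_var p)) ->
  forall f, cone P f -> cone P' (subst_var f).
Proof.
move=> hP; apply: cone_ind.
- by rewrite rmorph0; exact: cone0.
- by move=> f g hf hg; rewrite rmorphD; exact: coneD.
- by move=> d p d0 pP; rewrite /subst_var linearZ; exact: hP.
Qed.

End Subst.

(** * Algebraic cones with scaled generators *)

Lemma mem_scale_union f g Z Z' p :
  p \in scale_fset f Z `|` scale_fset g Z' ->
  (exists2 z, z \in Z & p = f * z) \/ (exists2 z, z \in Z' & p = g * z).
Proof.
by rewrite inE => /orP[/imfsetP[z /= zZ ->]|/imfsetP[z /= zZ ->]]; [left|right];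
  exists z.
Qed.

(** The multiplier may be any polynomial, of whatever sign: it is absorbed into the generators, and
    the coefficients stay the same. *)
Lemma scale_cone f Z P : (forall p, p \in P -> f * p \in Z) ->
  forall h, cone P h -> cone Z (f * h).
Proof.
move=> hP; apply: cone_ind.
- by rewrite mulr0; exact: cone0.
- by move=> a b; rewrite mulrDr; exact: coneD.
- by move=> c p c0 pP; rewrite -scalerAr; apply: coneZ => //; exact: hP.
Qed.

Lemma scale_ideal V Y f Z Z' : V \subset Y -> (forall z, z \in Z -> f * z \in Z') ->
  forall h, ideal V Z h -> ideal Y Z' (f * h).
Proof.
move=> sVY hZ; apply: ideal_ind.
- by rewrite mulr0; exact: ideal0.
- by move=> a b; rewrite mulrDr; exact: idealD.
- move=> q z /(polysS sVY) hq zZ; rewrite mulrCA; apply: idealM => //.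
  exact/ideal_gen/hZ.
Qed.

(** Keeping [u] and [v] abstract covers both evaluations: the generators scaled by [u] return to the
    original ones and those scaled by [v] vanish. *)
Lemma subst_alg_cone X t c Z1 Z2 P1 P2 u v f : t \notin X ->
  {subset Z1 <= polys X} -> {subset P1 <= polys X} ->
  subst_var t c u = 1 -> subst_var t c v = 0 ->
  f \in polys X ->
  alg_cone (t |: X)%SET (scale_fset u Z1 `|` scale_fset v Z2)
    (scale_fset u P1 `|` scale_fset v P2) f ->
  alg_cone X Z1 P1 f.
Proof.
move=> tX Z1X P1X su sv fX [g [h [gI hC fE]]].
exists (subst_var t c g), (subst_var t c h); split.
- apply: subst_var_ideal gI => z /mem_scale_union[][z' z'Z ->].
    by rewrite rmorphM /= su mul1r (subst_var_id _ tX) ?Z1X //; exact: ideal_gen.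
  by rewrite rmorphM /= sv mul0r; exact: ideal0.
- apply: subst_var_cone hC => d p d0 /mem_scale_union[][p' p'P ->].
    by rewrite rmorphM /= su mul1r (subst_var_id _ tX) ?P1X //; exact: coneZ.
  by rewrite rmorphM /= sv mul0r scaler0; exact: cone0.
- by rewrite -rmorphD /= -fE (subst_var_id _ tX).
Qed.

Lemma alg_cone_scale_union X Y u Z1 Z2 P1 P2 f : X \subset Y ->
  alg_cone X Z1 P1 f -> alg_cone X Z2 P2 f ->
  alg_cone Y (scale_fset u Z1 `|` scale_fset (1 - u) Z2)
    (scale_fset u P1 `|` scale_fset (1 - u) P2) f.
Proof.
move=> sXY [g1 [h1 [g1I h1C f1]]] [g2 [h2 [g2I h2C f2]]].
have inl v w Z Z' z : z \in Z -> v * z \in scale_fset v Z `|` scale_fset w Z'.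
  by move=> zZ; rewrite inE; apply/orP; left; apply/imfsetP; exists z.
have inr v w Z Z' z : z \in Z' -> w * z \in scale_fset v Z `|` scale_fset w Z'.
  by move=> zZ; rewrite inE; apply/orP; right; apply/imfsetP; exists z.
(* Combine the two decompositions of [f] with weights [u] and [1 - u], separately for the ideal and
   the cone. *)
exists (u * g1 + (1 - u) * g2), (u * h1 + (1 - u) * h2); split.
- by apply: idealD; [apply: scale_ideal g1I|apply: scale_ideal g2I] => //;
    [exact: inl|exact: inr].
- by apply: coneD; [apply: scale_cone h1C|apply: scale_cone h2C];
    [exact: inl|exact: inr].
- by rewrite addrACA -!mulrDr -f1 -f2 -mulrDl addrC subrK mul1r.
Qed.

Lemma scale_union_polys V u v Z Z' : u \in polys V -> v \in polys V ->
  {subset Z <= polys V} -> {subset Z' <= polys V} ->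
  {subset scale_fset u Z `|` scale_fset v Z' <= polys V}.
Proof.
by move=> uV vV ZV Z'V p /mem_scale_union[][z hz ->]; apply: rpredM => //;
  [exact: ZV|exact: Z'V].
Qed.

Lemma alg_cone_polys V Z P f : {subset Z <= polys V} -> {subset P <= polys V} ->
  alg_cone V Z P f -> f \in polys V.
Proof.
move=> ZV PV [g [h [gI hC ->]]]; apply: rpredD; first exact: ideal_polys gI.
exact: cone_polys hC.
Qed.

End Polys.

Theorem theorem3p11 (n : nat) (X : {set 'I_n}) (t : 'I_n)
    (Z1 P1 Z2 P2 : {fset {mpoly rat[n]}})
    (le : rel 'X_{1..n}) (Z P : {fset {mpoly rat[n]}}) :
  t \notin X ->
  {subset Z1 <= polys X} -> {subset P1 <= polys X} ->
  {subset Z2 <= polys X} -> {subset P2 <= polys X} ->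
  monomial_order (t |: X) le ->
  is_intersect le X t Z1 P1 Z2 P2 (Z, P) ->
  forall f : {mpoly rat[n]},
    alg_cone X Z P f <-> alg_cone X Z1 P1 f /\ alg_cone X Z2 P2 f.
Proof.
move=> tX Z1X P1X Z2X P2X leP inter f.
have sXY : X \subset t |: X by exact: subsetUr.
have XtY : ('X_t : {mpoly rat[n]}) \in polys (t |: X).
  apply: polys_mon; apply/monosP => i; rewrite !inE negb_or mnmE.
  by rewrite eq_sym => /andP[/negPf ->].
have nXtY : (1 - 'X_t : {mpoly rat[n]})%R \in polys (t |: X).
  by apply: GRing.rpredB => //; exact: GRing.rpred1.
have toY W W' : {subset W <= polys X} -> {subset W' <= polys X} ->
    {subset scale_fset 'X_t W `|` scale_fset (1 - 'X_t)%R W'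
      <= polys (t |: X)}%fset.
  move=> hW hW'.
  by apply: scale_union_polys => // p hp; apply: (polysS sXY); auto.
have projE := project_alg_cone sXY leP (toY _ _ Z1X Z2X) (toY _ _ P1X P2X) inter.
split=> [/projE[fY fX]|[f1 f2]].
- split.
    (* At [t := 1] the factor ['X_t] becomes [1] and [1 - 'X_t] becomes [0]. *)
    apply: (subst_alg_cone (c := 1%R) tX Z1X P1X _ _ fX fY).
      by rewrite subst_varX mpolyC1.
    by rewrite GRing.rmorphB GRing.rmorph1 /= subst_varX mpolyC1 GRing.subrr.
  (* Swapping the unions lets [1 - 'X_t] play the role of [u], for the evaluation at [t := 0]. *)
  rewrite fsetUC [X in alg_cone _ _ X]fsetUC in fY.
  apply: (subst_alg_cone (c := 0%R) tX Z2X P2X _ _ fX fY).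
    by rewrite GRing.rmorphB GRing.rmorph1 /= subst_varX mpolyC0 GRing.subr0.
  by rewrite subst_varX mpolyC0.
- apply/projE; split; first by apply: alg_cone_scale_union f1 f2.
  exact: alg_cone_polys f1.
Qed.
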